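(* Let $A\in\mathbb{R}^{m\times n}$ ($m\ll n$), let $k$ be a positive integer, and let $y:=Ax+\eta$, where $x\in\mathbb{R}^n$ is $k$-compressible, $\eta\in\mathbb{R}^m$ and $S=\mathcal{L}_k(x)$. Let $q\ge k$ be a positive integer and let $\varphi=\frac{\sqrt5+1}{2}$. Suppose that the restricted isometry constants of $A$ satisfy $$\delta_{\max\{q,3k\}}<\frac{-1+\sqrt{1+\frac1\varphi\sqrt{\lceil\frac nk\rceil}}}{\sqrt{\lceil\frac nk\rceil}}.$$ Let $\lambda>0$ be chosen such that $$(1+\delta_q)\left(1-\frac{\frac1\varphi-\delta_{3k}}{1+\sqrt{\lceil\frac nk\rceil}\,\delta_{3k}}\right)<\lambda<(1-\delta_q)\left(1+\frac{\frac1\varphi-\delta_{3k}}{1+\sqrt{\lceil\frac nk\rceil}\,\delta_{3k}}\right),$$ and let the parameters $\alpha,\gamma>0$ satisfy $\frac1{1+\delta_q}\le\alpha\gamma\le\frac1{1-\delta_q}$. Then the sequence $\{x^{(p)}\}$ generated by the CNHT algorithm (with input $A,y,k,q,\lambda,\alpha,\gamma$) satisfies, for every $p\ge 0$, $$\|x^{(p+1)}-x_S\|_2\le\rho_1\|x^{(p)}-x_S\|_2+\frac{\lambda\varphi\sqrt{\lceil\frac nk\rceil(1+\delta_k)}}{1-\delta_q}\|\eta'\|_2,$$ where $\eta'=Ax_{\overline S}+\eta$, $$\rho_1:=\varphi\left(\delta_{3k}+\Delta(\lambda,\delta_q)\left(1+\sqrt{\lceil\tfrac nk\rceil}\,\delta_{3k}\right)\right),\qquad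 \Delta(\lambda,\delta_q):=\max\left\{\left|1-\tfrac{\lambda}{1-\delta_q}\right|,\left|1-\tfrac{\lambda}{1+\delta_q}\right|\right\},$$ and $\rho_1<1$. Moreover, $\{x^{(p)}\}$ converges to $x_S$ when $\eta'=0$.
   Context: Restricted isometry constant: for a positive integer $t$, $\delta_t$ is the smallest $\delta\in[0,1)$ such that $(1-\delta)\|z\|_2^2\le\|Az\|_2^2\le(1+\delta)\|z\|_2^2$ for all $t$-sparse $z\in\mathbb{R}^n$ (vectors with at most $t$ nonzero entries); a bound on $\delta_t$ includes the requirement that such a constant exists. Note that $\delta_t$ is nondecreasing in $t$. Notation: $\mathcal{H}_k(z)$ keeps the $k$ largest-magnitude entries of $z$ and sets the others to zero (ties broken by any fixed rule); $\mathcal{L}_k(z)$ is the support of $\mathcal{H}_k(z)$. For an index set $\Omega\subseteq\{1,\dots,n\}$, $\overline\Omega$ is its complement, $A_\Omega$ is the submatrix of columns of $A$ indexed by $\Omega$, and for a vector $x$, $x_\Omega\in\mathbb{R}^n$ (used as an argument of $A$ or compared with vectors in $\mathbb{R}^n$) equals $x$ on $\Omega$ and is zero elsewhere. Thus $x_S$ is the best $k$-term approximation of $x$. ''$k$-compressible'' is an informal term (well approximated by a $k$-sparse vector, not necessarily exactly $k$-sparse) and imposes no quantitative condition on $x$. For $\Omega\subseteq\{1,\dots,n\}$ and parameters $\alpha,\gamma>0$: $M(\Omega)\in\mathbb{R}^{n\times n}$ is the matrix with principal submatrix $M(\Omega)_{\Omega\times\Omega}=(A_\Omega^\top A_\Omega)^{-1}$,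 diagonal entries $[M(\Omega)]_{ii}=\alpha$ for $i\notin\Omega$, and all other entries zero; $Z(\Omega)=\operatorname{diag}(z_1,\dots,z_n)$ with $z_i=1$ for $i\in\Omega$ and $z_i=\gamma$ for $i\notin\Omega$. CNHT algorithm (compressed Newton-direction-based thresholding): start from $x^{(0)}=\mathbf 0$. For $p=0,1,2,\dots$: let $\Omega^p=\mathcal{L}_q(A^\top(y-Ax^{(p)}))$, set $u^{(p)}=x^{(p)}+\lambda M(\Omega^p)Z(\Omega^p)A^\top(y-Ax^{(p)})$, and $x^{(p+1)}=\mathcal{H}_k(u^{(p)})$. *)

(* Defs.v *)
From HB Require Import structures.
From mathcomp Require Import all_boot all_order all_algebra.
From mathcomp Require Import boolp classical_sets reals topology normedtype sequences.

Set Implicit Arguments.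
Unset Strict Implicit.
Unset Printing Implicit Defensive.

Import Order.TTheory GRing.Theory Num.Theory.
Import numFieldNormedType.Exports.

Local Open Scope ring_scope.

Section Vectors.
Context {R : realType}.

Definition l2norm {n : nat} (v : 'cV[R]_n) : R :=
  Num.sqrt (\sum_(i < n) v i 0 ^+ 2).

Definition supp {n : nat} (v : 'cV[R]_n) : {set 'I_n} :=
  [set i | v i 0 != 0]%SET.

Definition sparse {n : nat} (t : nat) (v : 'cV[R]_n) : bool :=
  (#|supp v| <= t)%N.

(* The vector written x_Omega, of the same length as x. *)
Definition vrestrict {n : nat} (Om : {set 'I_n}) (x : 'cV[R]_n) : 'cV[R]_n :=
  \col_i (if i \in Om then x i 0 else 0).

(* A choice, fixed once and for all, of t positions of largest magnitude in
   each vector (all the positions when n < t): this is where ties are broken. *)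
Definition selection_rule {n : nat} (sel : nat -> 'cV[R]_n -> {set 'I_n}) : Prop :=
  forall (t : nat) (z : 'cV[R]_n),
    #|sel t z| = minn t n /\
    (forall i j, i \in sel t z -> j \notin sel t z -> `|z j 0| <= `|z i 0|).

(* H_t(z) *)
Definition hard_thr {n : nat} (sel : nat -> 'cV[R]_n -> {set 'I_n})
    (t : nat) (z : 'cV[R]_n) : 'cV[R]_n :=
  vrestrict (sel t z) z.

(* L_t(z): it has fewer than t elements when z has fewer than t nonzero entries. *)
Definition thr_supp {n : nat} (sel : nat -> 'cV[R]_n -> {set 'I_n})
    (t : nat) (z : 'cV[R]_n) : {set 'I_n} :=
  supp (hard_thr sel t z).

Lemma selection_rule_exists (n : nat) :
  exists sel : nat -> 'cV[R]_n -> {set 'I_n}, selection_rule sel.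
Proof.
suff H t (z : 'cV[R]_n) : exists s : {set 'I_n}, #|s| = minn t n /\
    (forall i j, i \in s -> j \notin s -> `|z j 0| <= `|z i 0|).
  exists (fun t z => projT1 (cid (H t z))) => t z.
  exact: projT2 (cid (H t z)).
elim: t => [|t [s [cs hs]]].
  by exists finset.set0; rewrite cards0 min0n; split=> // i j; rewrite finset.inE.
have [nt|tn] := leqP n t.
  exists s; split=> //; rewrite cs.
  by rewrite (minn_idPr nt) (minn_idPr (leqW nt)).
have [i0 i0s] : exists i0, i0 \notin s.
  have : (0 < #|~: s|)%N by rewrite cardsCs finset.setCK card_ord cs (minn_idPl (ltnW tn)) subn_gt0.
  by move=> /card_gt0P[i]; rewrite finset.inE => ?; exists i.
case: (@Order.TotalTheory.arg_maxP _ _ _ i0 (fun i => i \notin s)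
  (fun i => `|z i 0|) i0s) => m ms mM.
exists (m |: s)%SET; split.
  by rewrite cardsU1 ms cs (minn_idPl (ltnW tn)) (minn_idPl tn).
move=> i j; rewrite !finset.inE negb_or => /orP[/eqP->|si] /andP[_ sj].
  exact: mM.
exact: hs.
Qed.

End Vectors.

Section RestrictedIsometry.
Context {R : realType} {m n : nat}.

Definition rip (A : 'M[R]_(m, n)) (t : nat) (d : R) : Prop :=
  forall z : 'cV[R]_n, sparse t z ->
    (1 - d) * l2norm z ^+ 2 <= l2norm (A *m z) ^+ 2 /\
    l2norm (A *m z) ^+ 2 <= (1 + d) * l2norm z ^+ 2.

Definition is_ric (A : 'M[R]_(m, n)) (t : nat) (d : R) : Prop :=
  [/\ 0 <= d, d < 1, rip A t d &
      forall d' : R, 0 <= d' -> d' < 1 -> rip A t d' -> d <= d'].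

Definition has_ric (A : 'M[R]_(m, n)) (t : nat) : Prop := exists d : R, is_ric A t d.

(* Meaningful under [has_ric A t] only (the value is 0 otherwise). *)
Definition ric (A : 'M[R]_(m, n)) (t : nat) : R := xget 0 (is_ric A t).

Lemma ricP (A : 'M[R]_(m, n)) (t : nat) : has_ric A t -> is_ric A t (ric A t).
Proof. by case=> d hd; exact: (xgetI 0 hd). Qed.

Lemma is_ric_unique (A : 'M[R]_(m, n)) (t : nat) (d d' : R) :
  is_ric A t d -> is_ric A t d' -> d = d'.
Proof.
move=> [d0 d1 dr dm] [e0 e1 er em]; apply/eqP.
by rewrite eq_le dm // em.
Qed.

End RestrictedIsometry.

Section CNHT.
Context {R : realType} {m n : nat}.

Definition subcols (A : 'M[R]_(m, n)) (Om : {set 'I_n}) : 'M[R]_(m, #|Om|) :=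
  colsub enum_val A.

(* E is the n x #|Om| matrix of the inclusion of Om in the set of all indices,
   so that E *m B *m E^T puts B in the Om x Om block and zeros elsewhere; see
   [Mmx_block] and [Mmx_notin]. *)
Definition Mmx (A : 'M[R]_(m, n)) (alpha : R) (Om : {set 'I_n}) : 'M[R]_n :=
  let E : 'M[R]_(n, #|Om|) := colsub enum_val 1%:M in
  E *m invmx ((subcols A Om)^T *m subcols A Om) *m E^T
  + diag_mx (\row_i (if i \in Om then 0 else alpha)).

Definition Zmx (gamma : R) (Om : {set 'I_n}) : 'M[R]_n :=
  diag_mx (\row_i (if i \in Om then 1 else gamma)).

Definition cnht_step (sel : nat -> 'cV[R]_n -> {set 'I_n})
    (A : 'M[R]_(m, n)) (y : 'cV[R]_m) (k q : nat) (lambda alpha gamma : R)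
    (xp : 'cV[R]_n) : 'cV[R]_n :=
  let g := A^T *m (y - A *m xp) in
  let Om := thr_supp sel q g in
  hard_thr sel k (xp + lambda *: (Mmx A alpha Om *m Zmx gamma Om *m g)).

Definition cnht (sel : nat -> 'cV[R]_n -> {set 'I_n})
    (A : 'M[R]_(m, n)) (y : 'cV[R]_m) (k q : nat) (lambda alpha gamma : R)
    (p : nat) : 'cV[R]_n :=
  iter p (cnht_step sel A y k q lambda alpha gamma) 0.

Lemma Mmx_block (A : 'M[R]_(m, n)) alpha Om :
  mxsub enum_val enum_val (Mmx A alpha Om)
  = invmx ((subcols A Om)^T *m subcols A Om).
Proof.
rewrite /Mmx; set B := invmx _; apply/matrixP => a b.
have E1 c d : (colsub enum_val 1%:M : 'M[R]_(n, #|Om|)) (enum_val c) d = (c == d)%:R.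
  by rewrite !mxE (inj_eq enum_val_inj).
rewrite mxE [LHS]mxE [X in _ + X]mxE [X in X *+ _]mxE enum_valP mul0rn addr0.
rewrite [LHS]mxE (bigD1 b) //= [X in _ + X]big1 => [|j jb].
  rewrite [_^T _ _]mxE E1 eqxx mulr1 addr0 mxE (bigD1 a) //= [X in _ + X]big1 => [|j ja].
    by rewrite E1 eqxx mul1r addr0.
  by rewrite E1 eq_sym (negbTE ja) mul0r.
by rewrite [_^T _ _]mxE E1 eq_sym (negbTE jb) mulr0.
Qed.

Lemma Mmx_notin (A : 'M[R]_(m, n)) alpha (Om : {set 'I_n}) (i j : 'I_n) :
    (i \notin Om) || (j \notin Om) ->
  Mmx A alpha Om i j = (if i == j then alpha else 0).
Proof.
move=> ij; rewrite /Mmx; set B := invmx _; rewrite !mxE big1 => [|b _].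
  by rewrite add0r; case: eqP => [e|]; rewrite ?mulr0n// mulr1n; move: ij; rewrite e orbb => /negbTE ->.
rewrite !mxE.
case/orP: ij => h; last first.
  have -> : (j == enum_val b) = false.
    by apply/eqP => e; move: h; rewrite e enum_valP.
  by rewrite mulr0.
rewrite big1 ?mul0r // => a _; rewrite !mxE.
have -> : (i == enum_val a) = false.
  by apply/eqP => e; move: h; rewrite e enum_valP.
by rewrite mul0r.
Qed.

End CNHT.

(* The ratio n / k rounded up, as a real number. *)
Definition ceil_ratio (R : realType) (n k : nat) : R :=
  (Num.ceil (n%:R / k%:R : R))%:~R.

Definition golden (R : realType) : R := (Num.sqrt 5 + 1) / 2.

Definition Delta (R : realType) (lambda d : R) : R :=
  Num.max `|1 - lambda / (1 - d)| `|1 - lambda / (1 + d)|.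

(* Main.v *)
(* Write w = x_S - x^(p), h = A^T A w and D = M Z. Then x^(p) + lambda D A^T (y - A x^(p)) - x_S
   equals -(w - h) - (h - lambda D h) + lambda D A^T eta'. Hard thresholding costs a factor
   phi and only sees the entries in S and in the support of x^(p+1), where |w - h| is at most
   delta_3k |w|. Since the spectrum of D lies in [1/(1+delta_q), 1/(1-delta_q)], the
   second term is at most Delta |h|, and cutting the indices into ceil(n/k) blocks
   of length k gives |h| <= (1 + sqrt(ceil(n/k)) delta_3k) |w|; the noise term
   is bounded in the same way. The condition on lambda says Delta < r, i.e. rho_1 < 1. *)
Require Import Defs.
From mathcomp Require Import all_boot all_order all_algebra.
From mathcomp Require Import boolp classical_sets reals topology normedtype sequences.
From mathcomp Require Import ring lra.

Set Implicit Arguments.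
Unset Strict Implicit.
Unset Printing Implicit Defensive.

Import Order.TTheory GRing.Theory Num.Theory.
Import numFieldNormedType.Exports.

Local Open Scope ring_scope.

(** * Inner product, Euclidean norm and restriction to index sets *)

Section Euclidean.
Context {R : realType}.

Definition dot {n : nat} (u v : 'cV[R]_n) : R := \sum_(i < n) u i 0 * v i 0.

Lemma dotC n (u v : 'cV[R]_n) : dot u v = dot v u.
Proof. by apply: eq_bigr => i _; rewrite mulrC. Qed.

Lemma dotDl n (u v w : 'cV[R]_n) : dot (u + v) w = dot u w + dot v w.
Proof. by rewrite -big_split; apply: eq_bigr => i _; rewrite mxE mulrDl. Qed.

Lemma dotZl n a (u w : 'cV[R]_n) : dot (a *: u) w = a * dot u w.
Proof. by rewrite mulr_sumr; apply: eq_bigr => i _; rewrite mxE mulrA. Qed.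

Lemma dotNl n (u w : 'cV[R]_n) : dot (- u) w = - dot u w.
Proof. by rewrite -scaleN1r dotZl mulN1r. Qed.

Lemma dotDr n (u v w : 'cV[R]_n) : dot w (u + v) = dot w u + dot w v.
Proof. by rewrite dotC dotDl !(dotC w). Qed.

Lemma dotZr n a (u w : 'cV[R]_n) : dot w (a *: u) = a * dot w u.
Proof. by rewrite dotC dotZl dotC. Qed.

Lemma dotNr n (u w : 'cV[R]_n) : dot w (- u) = - dot w u.
Proof. by rewrite dotC dotNl dotC. Qed.

Definition dotE := (dotDl, dotDr, dotZl, dotZr, dotNl, dotNr).

Lemma dot_mulmx m n (A : 'M[R]_(m, n)) u v : dot (A *m u) v = dot u (A^T *m v).
Proof.
rewrite /dot; under eq_bigr => i _ do rewrite mxE mulr_suml.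
rewrite exchange_big; apply: eq_bigr => j _ /=.
rewrite mxE mulr_sumr; apply: eq_bigr => i _.
by rewrite mxE; ring.
Qed.

Lemma dotvv_ge0 n (u : 'cV[R]_n) : 0 <= dot u u.
Proof. by apply: sumr_ge0 => i _; rewrite -expr2 sqr_ge0. Qed.

Lemma l2norm_ge0 n (u : 'cV[R]_n) : 0 <= l2norm u.
Proof. exact: sqrtr_ge0. Qed.

Lemma sqr_l2norm n (u : 'cV[R]_n) : l2norm u ^+ 2 = dot u u.
Proof.
have e : \sum_(i < n) u i 0 ^+ 2 = dot u u by apply: eq_bigr => i _; rewrite expr2.
by rewrite /l2norm e sqr_sqrtr // dotvv_ge0.
Qed.

Lemma l2norm_le n m (u : 'cV[R]_n) (v : 'cV[R]_m) :
  (l2norm u <= l2norm v) = (dot u u <= dot v v).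
Proof. by rewrite -!sqr_l2norm ler_sqr // nnegrE l2norm_ge0. Qed.

Lemma l2norm_leP n (u : 'cV[R]_n) a : 0 <= a -> (l2norm u <= a) = (dot u u <= a ^+ 2).
Proof. by move=> a0; rewrite -!sqr_l2norm ler_sqr // nnegrE l2norm_ge0. Qed.

Lemma normr_coord_le_l2norm n (u : 'cV[R]_n) i : `|u i 0| <= l2norm u.
Proof.
rewrite -[l2norm u]ger0_norm ?l2norm_ge0 // -ler_sqr ?nnegrE ?normr_ge0 //.
rewrite !real_normK ?num_real // sqr_l2norm /dot (bigD1 i) //= -expr2 lerDl.
by apply: sumr_ge0 => j _; rewrite -expr2 sqr_ge0.
Qed.

Lemma l2norm_eq0 n (u : 'cV[R]_n) : l2norm u = 0 -> u = 0.
Proof.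
move=> u0; apply/matrixP => i j; rewrite ord1 mxE; apply/eqP.
by rewrite -normr_le0 -u0 normr_coord_le_l2norm.
Qed.

Lemma l2norm0 n : l2norm (0 : 'cV[R]_n) = 0.
Proof. by rewrite /l2norm big1 ?sqrtr0 // => i _; rewrite mxE expr0n. Qed.

Lemma l2normZ n a (u : 'cV[R]_n) : l2norm (a *: u) = `|a| * l2norm u.
Proof.
apply/eqP; rewrite -(@eqrXn2 _ 2) // ?mulr_ge0 ?l2norm_ge0 ?normr_ge0 //.
by rewrite exprMn !sqr_l2norm !dotE real_normK ?num_real // expr2 mulrA.
Qed.

(** Cauchy-Schwarz: for nonzero vectors, expand the square of |v| u - |u| v, which is nonnegative,
    and divide by |u| |v|. *)
Lemma dot_le_l2norm n (u v : 'cV[R]_n) : dot u v <= l2norm u * l2norm v.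
Proof.
have [/l2norm_eq0->|u0] := eqVneq (l2norm u) 0.
  by rewrite l2norm0 mul0r -(scale0r 0) dotZl mul0r.
have [/l2norm_eq0->|v0] := eqVneq (l2norm v) 0.
  by rewrite l2norm0 mulr0 -(scale0r 0) dotZr mul0r.
have := dotvv_ge0 (l2norm v *: u - l2norm u *: v).
rewrite !dotE -!sqr_l2norm (dotC v u).
have {}u0 : 0 < l2norm u by rewrite lt_def u0 l2norm_ge0.
have {}v0 : 0 < l2norm v by rewrite lt_def v0 l2norm_ge0.
move=> h; rewrite -(ler_pM2l (mulr_gt0 u0 v0)); lra.
Qed.

Lemma ler_l2normD n (u v : 'cV[R]_n) : l2norm (u + v) <= l2norm u + l2norm v.
Proof.
rewrite l2norm_leP ?addr_ge0 ?l2norm_ge0 //.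
rewrite !dotE -!sqr_l2norm (dotC v u); have := dot_le_l2norm u v; lra.
Qed.

Lemma l2normN n (u : 'cV[R]_n) : l2norm (- u) = l2norm u.
Proof. by rewrite -scaleN1r l2normZ normrN normr1 mul1r. Qed.

Lemma dot_vrestrict n V (u v : 'cV[R]_n) :
  dot (vrestrict V u) v = \sum_(i in V) u i 0 * v i 0.
Proof.
rewrite [RHS]big_mkcond; apply: eq_bigr => i _; rewrite mxE.
by case: ifP => // _; rewrite mul0r.
Qed.

Lemma dotvv_vrestrict n V (u : 'cV[R]_n) :
  dot (vrestrict V u) (vrestrict V u) = \sum_(i in V) u i 0 ^+ 2.
Proof.
by rewrite dot_vrestrict; apply: eq_bigr => i iV; rewrite mxE iV expr2.
Qed.

Lemma l2norm_vrestrict_le n V (u : 'cV[R]_n) : l2norm (vrestrict V u) <= l2norm u.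
Proof.
rewrite l2norm_le dotvv_vrestrict /dot [leRHS](bigID (mem V)) /=.
rewrite -[leLHS]addr0; apply: lerD.
  by apply: ler_sum => i _; rewrite expr2.
by apply: sumr_ge0 => i _; rewrite -expr2 sqr_ge0.
Qed.

Lemma l2norm_pythagoras n V (v : 'cV[R]_n) :
  dot v v = dot (vrestrict V v) (vrestrict V v)
            + dot (vrestrict (~: V)%SET v) (vrestrict (~: V)%SET v).
Proof.
rewrite !dotvv_vrestrict /dot (bigID (mem V)) /=; congr (_ + _).
by apply: eq_big => [i|i _]; rewrite ?expr2 // finset.inE.
Qed.

Lemma vrestrictZ n V a (u : 'cV[R]_n) : vrestrict V (a *: u) = a *: vrestrict V u.
Proof. by apply/matrixP => i j; rewrite !mxE; case: ifP => _; rewrite ?mulr0. Qed.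

Lemma vrestrictB n V (u v : 'cV[R]_n) :
  vrestrict V (u - v) = vrestrict V u - vrestrict V v.
Proof. by apply/matrixP => i j; rewrite !mxE; case: ifP => _; rewrite ?subr0. Qed.

Lemma vrestrictN n V (u : 'cV[R]_n) : vrestrict V (- u) = - vrestrict V u.
Proof. by apply/matrixP => i j; rewrite !mxE; case: ifP => _; rewrite ?oppr0. Qed.

Lemma vrestrictD n V (u v : 'cV[R]_n) :
  vrestrict V (u + v) = vrestrict V u + vrestrict V v.
Proof. by apply/matrixP => i j; rewrite !mxE; case: ifP => _; rewrite ?addr0. Qed.

Lemma vrestrictC n V (u : 'cV[R]_n) : vrestrict V u + vrestrict (~: V) u = u.
Proof.
apply/matrixP => i j; rewrite ord1 !mxE finset.inE.
by case: (i \in V); rewrite ?addr0 ?add0r.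
Qed.

Lemma vrestrict_id n (V : {set 'I_n}) (u : 'cV[R]_n) : supp u \subset V -> vrestrict V u = u.
Proof.
move=> /fintype.subsetP sV; apply/matrixP => i j; rewrite ord1 mxE; case: ifP => // /negbT iV.
by apply/esym/eqP; apply: contraNT iV => ui; apply: sV; rewrite finset.inE.
Qed.

Lemma supp_vrestrict n (V : {set 'I_n}) (u : 'cV[R]_n) : supp (vrestrict V u) \subset V.
Proof. by apply/fintype.subsetP => i; rewrite finset.inE mxE; case: ifP => //; rewrite eqxx. Qed.

Lemma suppZD n (V : {set 'I_n}) a (u v : 'cV[R]_n) :
  supp u \subset V -> supp v \subset V -> supp (a *: u + v) \subset V.
Proof.
move=> /vrestrict_id <- /vrestrict_id <-; apply/fintype.subsetP => i.
by rewrite finset.inE !mxE; case: (i \in V) => //; rewrite mulr0 addr0 eqxx.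
Qed.

Lemma suppN n (u : 'cV[R]_n) : supp (- u) = supp u.
Proof. by apply/setP => i; rewrite !finset.inE mxE oppr_eq0. Qed.

Lemma suppB n (V : {set 'I_n}) (u v : 'cV[R]_n) :
  supp u \subset V -> supp v \subset V -> supp (u - v) \subset V.
Proof. by move=> uV vV; rewrite -[u]scale1r; apply: suppZD; rewrite ?suppN. Qed.

(* The index set is cut into at most ceil (n / k) consecutive blocks of length k. *)
Lemma l2norm_blocks n k (v : 'cV[R]_n) C : (0 < k)%N -> 0 <= C ->
  (forall V : {set 'I_n}, (#|V| <= k)%N -> l2norm (vrestrict V v) <= C) ->
  l2norm v <= Num.sqrt (ceil_ratio R n k) * C.
Proof.
move=> k0 C0 hV.
have nk0 : 0 <= n%:R / k%:R :> R by rewrite divr_ge0.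
have c0 : 0 <= Num.ceil (n%:R / k%:R : R).
  by rewrite ceil_ge0 (lt_le_trans _ nk0) // ltrN10.
have cE : ceil_ratio R n k = `|Num.ceil (n%:R / k%:R : R)|%N%:R.
  by rewrite /ceil_ratio -{1}(gez0_abs c0).
set N := `|_|%N in cE.
have nNk : (n <= N * k)%N.
  rewrite -(ler_nat R) natrM -cE -ler_pdivrMr ?ltr0n //; exact: ceil_ge.
pose B (b : 'I_N) : {set 'I_n} := [set i : 'I_n | (i %/ k)%N == b]%SET.
have cB b : (#|B b| <= k)%N.
  (* Inside a block the quotient by k is fixed, so the remainder determines the index. *)
  pose f (i : 'I_n) : 'I_k := Ordinal (ltn_pmod i k0).
  have inj_f : {in B b &, injective f}.
    move=> i j; rewrite !finset.inE => /eqP ib /eqP jb [ij].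
    by apply/val_inj; rewrite /= (divn_eq i k) (divn_eq j k) ib jb ij.
  by rewrite -(card_in_imset inj_f) (leq_trans (max_card _)) // card_ord.
rewrite l2norm_leP ?mulr_ge0 ?sqrtr_ge0 // exprMn sqr_sqrtr ?cE ?ler0n //.
have -> : dot v v = \sum_(b < N) \sum_(i in B b) v i 0 ^+ 2.
  have lt_blk (i : 'I_n) : (i %/ k < N)%N by rewrite ltn_divLR // (leq_trans _ nNk).
  rewrite /dot (partition_big (fun i => Ordinal (lt_blk i)) predT) //=.
  apply: eq_bigr => b _; apply: eq_big => [i|i _]; last by rewrite expr2.
  by rewrite finset.inE.
have -> : N%:R * C ^+ 2 = \sum_(b < N) C ^+ 2.
  by rewrite sumr_const card_ord mulr_natl.
by apply: ler_sum => b _; rewrite -dotvv_vrestrict -l2norm_leP // hV.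
Qed.

End Euclidean.

(** * Hard thresholding and its golden-ratio error bound *)

Section HardThresholding.
Context {R : realType} {n : nat} (sel : nat -> 'cV[R]_n -> {set 'I_n}).
Context (selP : selection_rule sel).

Lemma card_sel_le k (z : 'cV[R]_n) : (#|sel k z| <= k)%N.
Proof. by have [-> _] := selP k z; exact: geq_minl. Qed.

Lemma supp_hard_thr k (z : 'cV[R]_n) : supp (hard_thr sel k z) \subset sel k z.
Proof. exact: supp_vrestrict. Qed.

Lemma card_thr_supp k (z : 'cV[R]_n) : (#|thr_supp sel k z| <= k)%N.
Proof. exact: leq_trans (subset_leq_card (supp_hard_thr k z)) (card_sel_le k z). Qed.

(** Exchange argument. With T = [sel k u], |T| = min(k, n) >= |S| gives |S \ T| <= |T \ S|, and
    every entry of u on T \ S is at least as large as the largest one on S \ T. *)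
Lemma sel_sum_le k (u : 'cV[R]_n) (S : {set 'I_n}) : (#|S| <= k)%N ->
  \sum_(i in S :\: sel k u) u i 0 ^+ 2 <= \sum_(i in sel k u :\: S) u i 0 ^+ 2.
Proof.
move=> Sk; have [cT hT] := selP k u; set T := sel k u in cT hT *.
have cST : (#|S :\: T| <= #|T :\: S|)%N.
  have ST : (#|S| <= #|T|)%N by rewrite cT leq_min Sk -[X in (_ <= X)%N]card_ord max_card.
  by rewrite !cardsD (finset.setIC T S) leq_sub2r.
have [->|[i0 i0D]] := set_0Vmem (S :\: T).
  by rewrite big_set0 sumr_ge0 // => i _; rewrite sqr_ge0.
case: (@Order.TotalTheory.arg_maxP _ _ _ i0 (mem (S :\: T))
  (fun i => u i 0 ^+ 2) i0D) => m mD mM.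
apply: (@le_trans _ _ (\sum_(i in S :\: T) u m 0 ^+ 2)).
  by apply: ler_sum => i; exact: mM.
rewrite sumr_const.
apply: (@le_trans _ _ (\sum_(i in T :\: S) u m 0 ^+ 2)).
  by rewrite sumr_const ler_wpMn2l // sqr_ge0.
apply: ler_sum => i; rewrite finset.inE => /andP[_ iT].
have /finset.setDP[_ mT] : m \in S :\: T := mD.
rewrite -[leLHS]real_normK ?num_real // -[leRHS]real_normK ?num_real //.
by rewrite ler_sqr ?nnegrE ?normr_ge0 // hT.
Qed.

Lemma golden_gt0 : 0 < golden R.
Proof. by rewrite /golden divr_gt0 // ltr_wpDl // sqrtr_ge0. Qed.

Lemma sqr_golden : golden R ^+ 2 = golden R + 1.
Proof.
have h : Num.sqrt 5 ^+ 2 = 5 :> R by rewrite sqr_sqrtr.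
by rewrite /golden; field: h.
Qed.

(* With a, b the norms of u - z over sel k u and over supp z minus sel k u, the
   error is at most a^2 + (a + b)^2, whose largest value on a^2 + b^2 = 1 is the
   top eigenvalue (3 + sqrt 5) / 2 = phi^2 of [[2, 1], [1, 1]]. *)
Lemma hard_thr_golden k (u z : 'cV[R]_n) (S : {set 'I_n}) :
  (#|S| <= k)%N -> supp z \subset S ->
  l2norm (hard_thr sel k u - z) <= golden R * l2norm (vrestrict (S :|: sel k u) (u - z)).
Proof.
move=> Sk /vrestrict_id zS; set T := sel k u.
set a := l2norm (vrestrict T (u - z)); set b := l2norm (vrestrict (S :\: T) (u - z)).
have ab : l2norm (vrestrict (S :|: T) (u - z)) ^+ 2 = a ^+ 2 + b ^+ 2.
  rewrite !sqr_l2norm !dotvv_vrestrict (big_setID T) /=.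
  by rewrite finset.setIC finset.setKU finset.setDUl finset.setDv finset.setU0.
(* The mass of u on S \ T is at most its mass on T \ S, where z vanishes, so the latter is part of
   a. *)
have zb : l2norm (vrestrict (S :\: T) z) <= b + a.
  have -> : vrestrict (S :\: T) z =
      - vrestrict (S :\: T) (u - z) + vrestrict (S :\: T) u.
    by rewrite vrestrictB opprB subrK.
  rewrite (le_trans (ler_l2normD _ _)) // l2normN lerD2l l2norm_le !dotvv_vrestrict.
  rewrite (le_trans (sel_sum_le u Sk)) // [leRHS](big_setID S) /= -[leLHS]add0r.
  apply: lerD; first by apply: sumr_ge0 => i _; rewrite sqr_ge0.
  apply: ler_sum => i; rewrite finset.inE => /andP[iS _].
  by rewrite -zS !mxE (negbTE iS) subr0.
have e : l2norm (hard_thr sel k u - z) ^+ 2 =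
    a ^+ 2 + l2norm (vrestrict (S :\: T) z) ^+ 2.
  rewrite !sqr_l2norm !dotvv_vrestrict /dot.
  rewrite [LHS](bigID (mem T)) /=; congr (_ + _).
    by apply: eq_bigr => i iT; rewrite !mxE iT expr2.
  rewrite [LHS](bigID (mem S)) /= [X in _ + X]big1 ?addr0.
    apply: eq_big => [i|i /andP[iT _]]; first by rewrite finset.inE.
    by rewrite !mxE (negbTE iT) sub0r expr2 mulrNN.
  by move=> i /andP[iT iS]; rewrite -zS !mxE (negbTE iT) (negbTE iS) subr0 mulr0.
have p0 := golden_gt0; have p2 := sqr_golden.
have a0 : 0 <= a by exact: l2norm_ge0.
have b0 : 0 <= b by exact: l2norm_ge0.
rewrite -ler_sqr ?nnegrE; [|exact: l2norm_ge0|by rewrite mulr_ge0 ?l2norm_ge0 ?ltW].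
rewrite exprMn ab e.
have : l2norm (vrestrict (S :\: T) z) ^+ 2 <= (b + a) ^+ 2.
  by rewrite ler_sqr ?nnegrE ?l2norm_ge0 ?addr_ge0.
move: (l2norm _ ^+ 2) => w wb.
suff : 0 <= golden R ^+ 2 * (a ^+ 2 + b ^+ 2) - a ^+ 2 - (b + a) ^+ 2 by lra.
(* By phi^2 = phi + 1 the form equals (phi - 1) a^2 - 2 a b + phi b^2; one more factor phi makes it
   a perfect square. *)
rewrite -(pmulr_rge0 _ p0).
have -> : golden R * (golden R ^+ 2 * (a ^+ 2 + b ^+ 2) - a ^+ 2 - (b + a) ^+ 2)
  = (a - golden R * b) ^+ 2.
  by ring: p2.
exact: sqr_ge0.
Qed.

End HardThresholding.

(** * Consequences of the restricted isometry property *)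

Section RestrictedIsometryBounds.
Context {R : realType} {m n : nat}.
Implicit Types (A : 'M[R]_(m, n)) (t : nat) (d : R).

Lemma sparse_supp (V : {set 'I_n}) t (u : 'cV[R]_n) :
  (#|V| <= t)%N -> supp u \subset V -> sparse t u.
Proof. by move=> Vt uV; exact: leq_trans (subset_leq_card uV) Vt. Qed.

Lemma rip_leq A s t d : (s <= t)%N -> rip A t d -> rip A s d.
Proof. by move=> st h z zs; apply: h; exact: leq_trans zs st. Qed.

(** The smallest constant is the infimum of the admissible ones: for each nonzero z the two
    inequalities are lower bounds on the constant, and lower bounds pass to the infimum. This makes
    existence of the constant monotone in t. *)
Lemma rip_has_ric A t d : 0 <= d -> d < 1 -> rip A t d -> has_ric A t.
Proof.
move=> d0 d1 dr.
pose E : set R := [set e | [/\ 0 <= e, e < 1 & rip A t e]]%classic.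
have Ed : E d by [].
have Elb : has_lbound E by exists 0 => e [].
have infE e : 0 <= e -> e < 1 -> rip A t e -> inf E <= e by move=> *; apply: ge_inf.
exists (inf E); split=> //.
- by apply: lb_le_inf => [|e []//]; exists d.
- exact: le_lt_trans (infE _ d0 d1 dr) d1.
(* For z of norm zero the inequalities do not depend on the constant, so those for [d] serve. *)
move=> z zt; have [N0|N0] := eqVneq (l2norm z ^+ 2) 0.
  by have := dr z zt; rewrite N0 !mulr0.
have {}N0 : 0 < l2norm z ^+ 2 by rewrite lt_def N0 sqr_ge0.
have inf_ge e : (forall d', E d' -> e <= d') -> e <= inf E.
  by move=> h; apply: lb_le_inf; [exists d | exact: h].
split; [suff : 1 - l2norm (A *m z) ^+ 2 / l2norm z ^+ 2 <= inf E
       |suff : l2norm (A *m z) ^+ 2 / l2norm z ^+ 2 - 1 <= inf E].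
- by rewrite -ler_pdivlMr //; lra.
- by apply: inf_ge => e [_ _ /(_ z zt)[+ _]]; rewrite -ler_pdivlMr //; lra.
- by rewrite -ler_pdivrMr //; lra.
- by apply: inf_ge => e [_ _ /(_ z zt)[_]]; rewrite -ler_pdivrMr //; lra.
Qed.

Lemma has_ric_leq A s t : (s <= t)%N -> has_ric A t -> has_ric A s.
Proof. by move=> st [d [d0 d1 dr _]]; exact: rip_has_ric d0 d1 (rip_leq st dr). Qed.

(* Polarization applied to s v + w and s v - w, where v is the restricted residual
   and s = 1 / d; then <v, w> - <A v, A w> = |v|^2. *)
Lemma rip_residual A t d (V W : {set 'I_n}) (w : 'cV[R]_n) :
  0 <= d -> rip A t d -> (#|W| <= t)%N -> V \subset W -> supp w \subset W ->
  l2norm (vrestrict V (w - A^T *m (A *m w))) <= d * l2norm w.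
Proof.
move=> d0 dr Wt VW wW; set r := w - _; set v := vrestrict V r.
have vr : dot v v = dot v w - dot (A *m v) (A *m w).
  rewrite dot_mulmx -dotNr -dotDr -/r dotvv_vrestrict dot_vrestrict.
  by apply: eq_bigr => i _; rewrite expr2.
have vW : supp v \subset W := fintype.subset_trans (supp_vrestrict _ _) VW.
have pol s : 2 * s * dot v v <= d * (s ^+ 2 * dot v v + dot w w).
  have [+ _] := dr (s *: v + w) (sparse_supp Wt (suppZD s vW wW)).
  have zW : supp (s *: v - w) \subset W by apply: suppZD; rewrite ?suppN.
  have [_] := dr (s *: v - w) (sparse_supp Wt zW).
  rewrite !sqr_l2norm !(mulmxDr, mulmxN) -!scalemxAr !dotE.
  rewrite (dotC w v) (dotC (A *m w)); have := congr1 ( *%R s) vr; lra.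
rewrite l2norm_leP ?mulr_ge0 ?l2norm_ge0 // exprMn sqr_l2norm.
have [e|dn0] := eqVneq d 0.
  by have := pol 1; rewrite e; lra.
have {dn0}d0 : 0 < d by rewrite lt_def dn0.
have := pol d^-1; rewrite -(ler_pM2l d0).
have -> : d * (2 * d^-1 * dot v v) = 2 * dot v v by field; exact: lt0r_neq0.
have -> : d * (d * (d^-1 ^+ 2 * dot v v + dot w w)) = dot v v + d ^+ 2 * dot w w.
  by field; exact: lt0r_neq0.
lra.
Qed.

(** Duality: with v the restriction of A^T e to V, |v|^2 = <A v, e>, and v is sparse enough for |A
    v| <= sqrt(1 + d) |v|; then cancel |v|. *)
Lemma rip_tr_bound A t d (V : {set 'I_n}) (e : 'cV[R]_m) :
  0 <= d -> rip A t d -> (#|V| <= t)%N ->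
  l2norm (vrestrict V (A^T *m e)) <= Num.sqrt (1 + d) * l2norm e.
Proof.
move=> d0 dr Vt; set v := vrestrict V _.
have vv : l2norm v ^+ 2 = dot (A *m v) e.
  rewrite sqr_l2norm dot_mulmx dotvv_vrestrict dot_vrestrict.
  by apply: eq_bigr => i _; rewrite expr2.
have Av : l2norm (A *m v) <= Num.sqrt (1 + d) * l2norm v.
  have d1 : 0 <= 1 + d by rewrite addr_ge0.
  rewrite l2norm_leP ?mulr_ge0 ?sqrtr_ge0 ?l2norm_ge0 //.
  rewrite exprMn sqr_sqrtr // -sqr_l2norm.
  by have [] := dr v (sparse_supp Vt (supp_vrestrict _ _)).
have [->|v0] := eqVneq (l2norm v) 0; first by rewrite mulr_ge0 ?sqrtr_ge0 ?l2norm_ge0.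
have {}v0 : 0 < l2norm v by rewrite lt_def v0 l2norm_ge0.
rewrite -(ler_pM2l v0) -expr2 vv (le_trans (dot_le_l2norm _ _)) //.
by rewrite mulrA ler_wpM2r ?l2norm_ge0 // mulrC.
Qed.

End RestrictedIsometryBounds.

(** * The matrix D = M Z on and off the selected set *)

Section NewtonDirection.
Context {R : realType} {m n : nat}.
Implicit Types (A : 'M[R]_(m, n)) (Om : {set 'I_n}) (h v : 'cV[R]_n).

Let incl Om : 'M[R]_(n, #|Om|) := colsub enum_val 1%:M.

Lemma tr_incl_mul Om h : (incl Om)^T *m h = rowsub enum_val h.
Proof. by rewrite /incl trmx_mxsub trmx1 mul_rowsub_mx mul1mx. Qed.

Lemma mul_incl_rowsub Om h : incl Om *m rowsub enum_val h = vrestrict Om h.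
Proof.
apply/matrixP => i j; rewrite ord1 !mxE.
under eq_bigr => a _ do rewrite !mxE.
case: ifP => [iO|/negbT iO].
  rewrite (bigD1 (enum_rank_in iO i)) //= enum_rankK_in // eqxx mul1r big1 ?addr0 //.
  move=> a ai; case: eqP => [ia|_]; last by rewrite mul0r.
  by case/eqP: ai; apply: enum_val_inj; rewrite enum_rankK_in.
rewrite big1 // => a _; case: eqP => [ia|_]; last by rewrite mul0r.
by rewrite ia enum_valP in iO.
Qed.

Lemma rowsub_incl Om (y : 'cV[R]_#|Om|) : rowsub enum_val (incl Om *m y) = y.
Proof.
rewrite -mul_rowsub_mx -[RHS]mul1mx; congr (_ *m _).
by apply/matrixP => a b; rewrite !mxE (inj_eq enum_val_inj).
Qed.

Lemma mulmx_incl A Om : A *m incl Om = subcols A Om.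
Proof. by rewrite /incl mulmx_colsub mulmx1. Qed.

(** If the Gram matrix kills z, then A kills the zero-padded z, which is supported in [Om]; as d <
    1, the lower isometry bound makes z zero. *)
Lemma gram_unitmx A t d Om : d < 1 -> rip A t d -> (#|Om| <= t)%N ->
  (subcols A Om)^T *m subcols A Om \in unitmx.
Proof.
move=> d1 dr Ot; set C := subcols A Om; rewrite -row_free_unit.
apply: inj_row_free => u u0; set z := u^T.
have Cz0 : dot (C *m z) (C *m z) = 0.
  rewrite dot_mulmx mulmxA -[X in X *m z]trmxK trmx_mul trmxK -trmx_mul u0 trmx0.
  by rewrite -(scale0r 0) dotZr mul0r.
have Ez : sparse t (incl Om *m z).
  rewrite -(rowsub_incl z) mul_incl_rowsub.
  exact: sparse_supp Ot (supp_vrestrict _ _).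
have [+ _] := dr _ Ez.
rewrite mulmxA mulmx_incl -/C [X in _ <= X]sqr_l2norm Cz0 pmulr_rle0 ?subr_gt0 // => E0.
have {}Ez : incl Om *m z = 0.
  by apply: l2norm_eq0; apply/eqP; rewrite -sqrf_eq0 eq_le E0 sqr_ge0.
by rewrite -[u]trmxK -/z -(rowsub_incl z) Ez; apply/matrixP => i j; rewrite !mxE.
Qed.

Section Fixed.
Context (A : 'M[R]_(m, n)) (t : nat) (d alpha gamma : R) (Om : {set 'I_n}).
Context (d0 : 0 <= d) (d1 : d < 1) (dr : rip A t d) (Ot : (#|Om| <= t)%N).

Let dir h := Mmx A alpha Om *m Zmx gamma Om *m h.

Lemma newton_notin h i : i \notin Om -> dir h i 0 = alpha * gamma * h i 0.
Proof.
move=> iO; rewrite /dir -mulmxA mxE (bigD1 i) //= big1 => [|j ji].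
  rewrite addr0 Mmx_notin ?iO // eqxx.
  by rewrite /Zmx mul_diag_mx !mxE (negbTE iO) mulrA.
by rewrite Mmx_notin ?iO // eq_sym (negbTE ji) mul0r.
Qed.

(** Normal equations: on [Om] the direction is the inverse Gram matrix applied to h, so applying the
    Gram matrix returns h. This form no longer mentions the inverse. *)
Lemma newton_in h :
  vrestrict Om (A^T *m (A *m vrestrict Om (dir h))) = vrestrict Om h.
Proof.
set G := (subcols A Om)^T *m subcols A Om.
have GU : G \in unitmx by exact: gram_unitmx dr Ot.
have rZ : rowsub enum_val (Zmx gamma Om *m h) = rowsub enum_val h :> 'cV[R]_#|Om|.
  by apply/matrixP => a j; rewrite /Zmx mul_diag_mx !mxE enum_valP mul1r.
have rv : rowsub enum_val (dir h) = invmx G *m rowsub enum_val h.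
  rewrite /dir /Mmx -/(incl Om) -/G -mulmxA mulmxDl -!mulmxA tr_incl_mul rZ.
  set y := invmx G *m _; rewrite -[RHS](rowsub_incl y).
  apply/matrixP => a j; rewrite [LHS]mxE [LHS]mxE [RHS]mxE.
  by rewrite mul_diag_mx [X in _ + X]mxE [X in X * _]mxE enum_valP mul0r addr0.
rewrite -(mul_incl_rowsub Om (dir h)) rv [A *m _]mulmxA mulmx_incl.
rewrite -!mul_incl_rowsub; congr (_ *m _).
by rewrite -tr_incl_mul mulmxA -trmx_mul mulmx_incl mulmxA -/G mulKVmx.
Qed.

(* On Om the residual bound says |h - v| <= d |v| for v = (A_Om^T A_Om)^{-1} h;
   completing the square puts v in the ball below. Off Om the factor
   alpha * gamma lies within d / (1 - d^2) of 1 / (1 - d^2). *)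
Lemma newton_ball h :
  (1 + d)^-1 <= alpha * gamma -> alpha * gamma <= (1 - d)^-1 ->
  l2norm (dir h - (1 - d ^+ 2)^-1 *: h) <= (1 - d ^+ 2)^-1 * d * l2norm h.
Proof.
move=> lo hi; set c := (1 - d ^+ 2)^-1.
(* Only these two properties of the direction are kept; its formula is forgotten. *)
have [v [vN vO ->]] : exists v : 'cV[R]_n,
    [/\ forall i, i \notin Om -> v i 0 = alpha * gamma * h i 0,
        vrestrict Om (A^T *m (A *m vrestrict Om v)) = vrestrict Om h & dir h = v].
  by exists (dir h); split=> //; [exact: newton_notin | exact: newton_in].
have dd : 0 < 1 - d ^+ 2 by rewrite subr_gt0 expr_lt1.
have c0 : 0 < c by rewrite invr_gt0.
have d1p : 0 < 1 + d by rewrite ltr_wpDr.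
have d1m : 0 < 1 - d by rewrite subr_gt0.
have cE : c * (1 - d ^+ 2) = 1 by rewrite mulVf ?lt0r_neq0.
rewrite l2norm_leP ?mulr_ge0 ?l2norm_ge0 ?(ltW c0) //.
rewrite (l2norm_pythagoras Om) exprMn sqr_l2norm (l2norm_pythagoras Om h) mulrDr.
apply: lerD; last first.
  have -> : vrestrict (~: Om)%SET (v - c *: h) =
      (alpha * gamma - c) *: vrestrict (~: Om)%SET h.
    apply/matrixP => i j; rewrite ord1 !mxE finset.inE.
    by case: (boolP (i \in Om)) => iO /=; rewrite ?mulr0 // vN // mulrBl.
  rewrite dotZl dotZr mulrA ler_wpM2r ?dotvv_ge0 // -expr2.
  (* The endpoints of the interval for alpha * gamma are c - c d and c + c d, so c is its
     midpoint. *)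
  have lo' : (1 + d)^-1 = c - c * d.
    by rewrite /c; field; rewrite !lt0r_neq0.
  have hi' : (1 - d)^-1 = c + c * d.
    by rewrite /c; field; rewrite !lt0r_neq0.
  rewrite -[leLHS]real_normK ?num_real // ler_sqr ?nnegrE ?normr_ge0 //.
    by rewrite ler_norml; apply/andP; split; lra.
  by rewrite mulr_ge0 // ltW.
have := rip_residual d0 dr Ot (subxx _) (supp_vrestrict Om v).
rewrite vrestrictB vO (vrestrict_id (supp_vrestrict _ _)).
rewrite l2norm_leP ?mulr_ge0 ?l2norm_ge0 // exprMn sqr_l2norm.
rewrite vrestrictB vrestrictZ.
rewrite !dotE (dotC _ (vrestrict Om v)) => /(ler_wpM2l (ltW c0)).
move: (dot _ _) (dot _ _) (dot _ _) => Q P N.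
(* Multiplying N - 2 P + Q <= d^2 N by c and using c (1 - d^2) = 1 gives N - 2 c P + c Q <= 0, where
   c Q = c^2 Q - (c d)^2 Q. *)
have cN := congr1 ( *%R^~ N) cE; have cQ := congr1 ( *%R^~ (c * Q)) cE.
by clearbody c; lra.
Qed.

End Fixed.
End NewtonDirection.

(** * Error bound for one iteration *)

Section Contraction.
Context {R : realType} {m n : nat}.

(** Turns the ball of [newton_ball] into the factor [Delta]. With c = 1 / (1 - d^2), the left side
    is 1 - lambda / (1 + d) if lambda c <= 1 and lambda / (1 - d) - 1 otherwise. *)
Lemma Delta_ge (lambda d : R) : 0 <= d -> d < 1 ->
  `|1 - lambda * (1 - d ^+ 2)^-1| + lambda * ((1 - d ^+ 2)^-1 * d) <= Delta lambda d.
Proof.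
move=> d0 d1; rewrite /Delta le_max.
have d1p : 1 + d != 0 by rewrite lt0r_neq0 // ltr_wpDr.
have d1m : 1 - d != 0 by rewrite lt0r_neq0 // subr_gt0.
have dd : 1 - d ^+ 2 != 0.
  by have -> : 1 - d ^+ 2 = (1 - d) * (1 + d) by [ring]; rewrite mulf_neq0.
set c := (1 - d ^+ 2)^-1.
have eE : lambda / (1 + d) = lambda * c - lambda * (c * d).
  by rewrite /c; field; rewrite dd d1p.
have fE : lambda / (1 - d) = lambda * c + lambda * (c * d).
  by rewrite /c; field; rewrite dd d1m.
have [_|_] := ger0P (1 - lambda * c); apply/orP; [right|left].
  by apply: le_trans (ler_norm _); rewrite eE opprB addrA addrAC.
by rewrite distrC; apply: le_trans (ler_norm _); rewrite fE; lra.
Qed.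

(** Stated for any admissible constants and any target supported on at most k indices; the theorem
    takes x_S as target and eta' as [e]. *)
Lemma cnht_step_bound (sel : nat -> 'cV[R]_n -> {set 'I_n}) (A : 'M[R]_(m, n))
    (k q : nat) (lambda alpha gamma dk dq d3k : R) (S : {set 'I_n})
    (x xp : 'cV[R]_n) (e : 'cV[R]_m) :
  selection_rule sel -> (0 < k)%N ->
  0 <= dk -> rip A k dk -> 0 <= dq -> dq < 1 -> rip A q dq ->
  0 <= d3k -> rip A (3 * k) d3k -> 0 < lambda ->
  (1 + dq)^-1 <= alpha * gamma -> alpha * gamma <= (1 - dq)^-1 ->
  (#|S| <= k)%N -> supp x \subset S -> sparse k xp ->
  l2norm (cnht_step sel A (A *m x + e) k q lambda alpha gamma xp - x)
  <= golden R * (d3k + Delta lambda dq * (1 + Num.sqrt (ceil_ratio R n k) * d3k))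
     * l2norm (xp - x)
     + lambda * golden R * Num.sqrt (ceil_ratio R n k * (1 + dk)) / (1 - dq) * l2norm e.
Proof.
move=> selP k0 dk0 rk dq0 dq1 rq d30 r3 l0 lo hi Sk xS xpk; set c := ceil_ratio R n k.
pose w := x - xp; pose h := A^T *m (A *m w); pose b := A^T *m e.
have gE : A^T *m (A *m x + e - A *m xp) = h + b.
  by rewrite /h /b -mulmxDr [A *m w]mulmxBr addrAC.
rewrite /cnht_step gE; set Om := thr_supp sel q _.
set D := Mmx A alpha Om *m Zmx gamma Om; set u := xp + _.
have Omq : (#|Om| <= q)%N := card_thr_supp selP _ _.
have := hard_thr_golden selP u Sk xS; set V := S :|: _ => hg; apply: (le_trans hg).
have uE : u - x = - (w - h) - (h - lambda *: (D *m h)) + lambda *: (D *m b).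
  rewrite /u mulmxDr scalerDr /w; move: (lambda *: _) (lambda *: _) => v1 v2.
  by apply/matrixP => i j; rewrite !mxE; ring.
have wN : l2norm (xp - x) = l2norm w by rewrite -l2normN opprB.
have wS : supp w \subset S :|: supp xp.
  apply: suppB; last exact: finset.subsetUr.
  exact: fintype.subset_trans xS (finset.subsetUl _ _).
(* The order 3k comes from here: S, the support of the current iterate, and one further set of size
   at most k. *)
have card3 (T : {set 'I_n}) : (#|T| <= k)%N -> (#|S :|: T :|: supp xp| <= 3 * k)%N.
  move=> Tk; rewrite (leq_trans (leq_card_setU _ _)) // 2!mulSn mul1n addnA leq_add //.
  by rewrite (leq_trans (leq_card_setU _ _)) // leq_add.
have res (T : {set 'I_n}) : (#|T| <= k)%N ->
    l2norm (vrestrict (S :|: T) (w - h)) <= d3k * l2norm w.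
  move=> Tk; apply: rip_residual d30 r3 (card3 T Tk) (finset.subsetUl _ _) _.
  by apply: fintype.subset_trans wS _; apply: finset.setSU; exact: finset.subsetUl.
(* [res] serves the set seen by thresholding, this bound the single blocks of length k used for
   |h|. *)
have resT (T : {set 'I_n}) : (#|T| <= k)%N ->
    l2norm (vrestrict T (w - h)) <= d3k * l2norm w.
  move=> Tk; apply: rip_residual d30 r3 (card3 T Tk) _ _.
    by rewrite -finset.setUA finset.setUCA; exact: finset.subsetUl.
  by apply: fintype.subset_trans wS _; apply: finset.setSU; exact: finset.subsetUl.
have hN : l2norm h <= (1 + Num.sqrt c * d3k) * l2norm w.
  have -> : h = w - (w - h) by rewrite subKr.
  rewrite (le_trans (ler_l2normD _ _)) // l2normN mulrDl mul1r lerD2l -mulrA.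
  by apply: l2norm_blocks => //; rewrite mulr_ge0 ?l2norm_ge0.
have bN : l2norm b <= Num.sqrt (c * (1 + dk)) * l2norm e.
  have c0 : 0 <= c by rewrite ler0z ceil_ge0 (lt_le_trans (@ltrN10 R)) // divr_ge0.
  rewrite sqrtrM // -mulrA; apply: l2norm_blocks => // [|T Tk].
    by rewrite mulr_ge0 ?l2norm_ge0 ?sqrtr_ge0.
  exact: rip_tr_bound dk0 rk Tk.
have ball v := newton_ball dq0 dq1 rq Omq v lo hi.
have hD : l2norm (h - lambda *: (D *m h)) <= Delta lambda dq * l2norm h.
  pose s := (1 - dq ^+ 2)^-1.
  (* Recentre D at s, the centre of the ball; [Delta_ge] absorbs both pieces. *)
  have -> : h - lambda *: (D *m h) =
      (1 - lambda * s) *: h - lambda *: (D *m h - s *: h).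
    by rewrite scalerBr scalerA scalerBl scale1r opprB addrA subrK.
  rewrite (le_trans (ler_l2normD _ _)) // l2normN !l2normZ (gtr0_norm l0).
  rewrite (le_trans _ (ler_wpM2r (l2norm_ge0 h) (Delta_ge lambda dq0 dq1))) //.
  by rewrite [leRHS]mulrDl lerD2l -mulrA ler_pM2l // ball.
have bD : l2norm (D *m b) <= (1 - dq)^-1 * l2norm b.
  pose s := (1 - dq ^+ 2)^-1.
  (* Centre plus radius of the ball is the norm bound for D. *)
  have sE : (1 - dq)^-1 = s + s * dq.
    rewrite /s; field.
    have -> : 1 - dq ^+ 2 = (1 - dq) * (1 + dq) by ring.
    by rewrite mulf_neq0 !lt0r_neq0 ?subr_gt0 ?ltr_wpDr.
  have s0 : 0 < s by rewrite invr_gt0 subr_gt0 expr_lt1.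
  rewrite -[D *m b](subrK (s *: b)) (le_trans (ler_l2normD _ _)) //.
  by rewrite sE mulrDl addrC lerD ?ball // l2normZ gtr0_norm.
rewrite uE !vrestrictD vrestrictN.
have -> : lambda * golden R * Num.sqrt (c * (1 + dk)) / (1 - dq) * l2norm e =
  golden R * (lambda * ((1 - dq)^-1 * (Num.sqrt (c * (1 + dk)) * l2norm e))) by ring.
rewrite -[X in _ <= X + _]mulrA -mulrDr (ler_pM2l golden_gt0).
(* The restriction to V is exploited only for w - h; on the other two terms it is dropped. *)
rewrite wN mulrDl (le_trans (ler_l2normD _ _)) // lerD //.
  rewrite (le_trans (ler_l2normD _ _)) // lerD //.
    by rewrite l2normN res // card_sel_le.
  rewrite (le_trans (l2norm_vrestrict_le _ _)) // l2normN (le_trans hD) // -mulrA ler_wpM2l //.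
  by rewrite /Delta le_max normr_ge0.
rewrite (le_trans (l2norm_vrestrict_le _ _)) // l2normZ gtr0_norm // ler_pM2l //.
by rewrite (le_trans bD) // ler_wpM2l // invr_ge0 subr_ge0 ltW.
Qed.

End Contraction.

(** * Convergence, the role of lambda, and the final assembly *)

Lemma cvg_l2norm_contraction (R : realType) (n : nat) (u : nat -> 'cV[R]_n)
    (l : 'cV[R]_n) (rho : R) :
  0 <= rho -> rho < 1 ->
  (forall p, l2norm (u p.+1 - l) <= rho * l2norm (u p - l)) ->
  (u p @[p --> \oo] --> l)%classic.
Proof.
move=> rho0 rho1 hu; pose C := l2norm (u 0 - l).
have geo p : l2norm (u p - l) <= geometric C rho p.
  elim: p => [|p IH]; first by rewrite /geometric /= expr0 mulr1.
  rewrite (le_trans (hu p)) // /geometric /= exprS mulrCA.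
  by rewrite ler_wpM2l.
have cv : (geometric C rho @ \oo --> (0 : R))%classic.
  by apply: cvg_geometric; rewrite ger0_norm.
(* Balls of column vectors are entrywise, and each entry is bounded by the Euclidean norm, which
   decays geometrically. *)
apply/cvg_ballP => e e0; near=> p.
split=> // i j; rewrite ord1 /ball /= distrC.
apply: (@le_lt_trans _ _ (l2norm (u p - l))).
  by have := normr_coord_le_l2norm (u p - l) i; rewrite !mxE.
apply: le_lt_trans (geo p) _; apply: le_lt_trans (ler_norm _) _.
by near: p; exact: cvgr0_norm_lt cv _ e0.
Unshelve. all: by end_near.
Qed.

Lemma sparse_cnht (R : realType) (m n k q : nat) (sel : nat -> 'cV[R]_n -> {set 'I_n})
    (A : 'M[R]_(m, n)) (y : 'cV[R]_m) (lambda alpha gamma : R) (p : nat) :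
  selection_rule sel -> sparse k (cnht sel A y k q lambda alpha gamma p).
Proof.
move=> selP; case: p => [|p]; last exact: card_thr_supp.
rewrite /sparse /cnht /= (_ : supp _ = finset.set0) ?cards0 //.
by apply/setP => i; rewrite !finset.inE mxE eqxx.
Qed.

Lemma Delta_lt (R : realType) (lambda d r : R) : 0 <= d -> d < 1 -> 0 < lambda ->
  (1 + d) * (1 - r) < lambda -> lambda < (1 - d) * (1 + r) -> Delta lambda d < r.
Proof.
move=> d0 d1 l0 lo hi; rewrite /Delta gt_max.
have d1p : 0 < 1 + d by rewrite ltr_wpDr.
have d1m : 0 < 1 - d by rewrite subr_gt0.
have lo' : 1 - r < lambda / (1 + d) by rewrite ltr_pdivlMr // mulrC.
have hi' : lambda / (1 - d) < 1 + r by rewrite ltr_pdivrMr // mulrC.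
(* Each condition on lambda bounds one quotient from one side; this ordering places both in (1 - r,
   1 + r). *)
have le' : lambda / (1 + d) <= lambda / (1 - d).
  by rewrite ler_pM2l // lef_pV2 //; lra.
rewrite !ltr_norml; apply/andP; split; apply/andP; split; lra.
Qed.

Theorem theorem3p4 (R : realType) (m n k q : nat) (A : 'M[R]_(m, n))
    (x : 'cV[R]_n) (eta : 'cV[R]_m) (lambda alpha gamma : R)
    (sel : nat -> 'cV[R]_n -> {set 'I_n}) :
  (m < n)%N -> (0 < k)%N -> (k <= q)%N ->
  selection_rule sel ->
  let phi := golden R in
  let c := ceil_ratio R n k in
  let y := A *m x + eta in
  let S := thr_supp sel k x in
  let xS := vrestrict S x in
  let eta' := A *m vrestrict (~: S)%SET x + eta in
  let dk := ric A k in
  let dq := ric A q in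
  let d3k := ric A (3 * k) in
  let r := (phi^-1 - d3k) / (1 + Num.sqrt c * d3k) in
  let rho1 := phi * (d3k + Delta lambda dq * (1 + Num.sqrt c * d3k)) in
  let xp := cnht sel A y k q lambda alpha gamma in
  has_ric A (maxn q (3 * k)) ->
  ric A (maxn q (3 * k)) < (-1 + Num.sqrt (1 + phi^-1 * Num.sqrt c)) / Num.sqrt c ->
  0 < lambda ->
  (1 + dq) * (1 - r) < lambda ->
  lambda < (1 - dq) * (1 + r) ->
  0 < alpha -> 0 < gamma ->
  (1 + dq)^-1 <= alpha * gamma ->
  alpha * gamma <= (1 - dq)^-1 ->
  [/\ (forall p : nat,
         l2norm (xp p.+1 - xS)
         <= rho1 * l2norm (xp p - xS)
            + lambda * phi * Num.sqrt (c * (1 + dk)) / (1 - dq) * l2norm eta'),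
      rho1 < 1 &
      eta' = 0 -> (xp p @[p --> \oo] --> xS)%classic].
Proof.
move=> mn k0 kq selP phi c y S xS eta' dk dq d3k r rho1 xp hric _ l0 lo hi a0 g0 alo ahi.
(* The orders k, q and 3k are all at most max(q, 3k), so each [ric] is a true minimum and not the
   default 0. *)
have ricE t : (t <= maxn q (3 * k))%N -> is_ric A t (ric A t).
  by move=> tq; apply: ricP; exact: has_ric_leq tq hric.
have [dk0 _ rk _] := ricE k (leq_trans kq (leq_maxl _ _)).
have [dq0 dq1 rq _] := ricE q (leq_maxl _ _).
have [d30 _ r3 _] := ricE (3 * k)%N (leq_maxr _ _).
(* The tail of x outside S is absorbed into the noise. *)
have yE : y = A *m xS + eta' by rewrite /eta' addrA -mulmxDr vrestrictC.
have step p : l2norm (xp p.+1 - xS) <= rho1 * l2norm (xp p - xS)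
    + lambda * phi * Num.sqrt (c * (1 + dk)) / (1 - dq) * l2norm eta'.
  rewrite /xp /cnht iterS yE -/(cnht _ _ _ _ _ _ _ _ p).
  apply: cnht_step_bound (card_thr_supp selP k x) (supp_vrestrict _ _) _ => //.
  exact: sparse_cnht.
have b0 : 0 < 1 + Num.sqrt c * d3k by rewrite ltr_wpDr // mulr_ge0 ?sqrtr_ge0.
have phi0 : 0 < phi := golden_gt0.
have rho1_lt1 : rho1 < 1.
  rewrite /rho1 mulrC -ltr_pdivlMr // div1r addrC -ltrBrDr -ltr_pdivlMr //.
  exact: Delta_lt.
split=> // eta0; apply: (@cvg_l2norm_contraction _ _ _ _ rho1) => // [|p].
  rewrite mulr_ge0 ?(ltW phi0) // addr_ge0 // mulr_ge0 ?(ltW b0) //.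
  by rewrite /Delta le_max normr_ge0.
by rewrite (le_trans (step p)) // eta0 l2norm0 mulr0 addr0.
Qed.
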